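(* Let $0\le m<N_T$ and $$J_{\mathrm{ave},m}=Z_m\sum_{j=1}^{m}\left(Z_j^{-1}-Z_{j-1}^{-1}\right)J_j .$$ Consider the constrained two-player zero-sum game with payoff matrix $Z$, transmitter strategy set $\mathbf{X}$ and jammer strategy set $\mathbf{Y}_{\mathrm{LE}|J_{\mathrm{ave},m}}$. Then the value of the game at the Nash equilibrium is $$Z(\boldsymbol{x}^*,\boldsymbol{y}^* )=Z_m,$$ and a Nash equilibrium pair $(\boldsymbol{x}^*,\boldsymbol{y}^* )$ of optimal mixed strategies is given by $$x_i^*=\frac{Z_m}{J_{m+1}-J_{\mathrm{ave},m}}\,(J_{i+1}-J_i)\,Z_i^{-1}\quad(0\le i\le m),\qquad x_i^*=0\quad(m<i\le N_T),$$ $$y_0^*=Z_mZ_0^{-1},\qquad y_j^*=Z_m\left(Z_j^{-1}-Z_{j-1}^{-1}\right)\quad(1\le j\le m),\qquad y_j^*=0\quad(m<j\le N_T).$$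
   Context: Let $N_T\ge 1$ be an integer. Jamming power levels: real numbers $0=J_0<J_1<\dots<J_{N_T}=J_{\max}$, collected in the column vector $\boldsymbol{J}=(J_0,\dots,J_{N_T})^T$. Payoffs: real numbers $Z_0>Z_1>\dots>Z_{N_T}>0$. The payoff matrix $Z$ is the $(N_T+1)\times(N_T+1)$ lower triangular matrix, indexed by $0\le i,j\le N_T$, with $(i,j)$ entry equal to $Z_i$ if $j\le i$ and $0$ if $j>i$ (the transmitter, using a strategy that withstands jamming power up to $J_i$, receives $Z_i$ if the actual jamming power $J_j$ satisfies $J_j\le J_i$, and $0$ otherwise). The row player (transmitter) maximizes and the column player (jammer) minimizes. $\mathbf{X}=\mathbf{Y}$ is the set of probability vectors in $\mathbb{R}^{N_T+1}$ (entries indexed by $0,\dots,N_T$). For $0\le J_{\mathrm{ave}}\le J_{\max}$, $\mathbf{Y}_{\mathrm{LE}|J_{\mathrm{ave}}}=\{\boldsymbol{y}\in\mathbf{Y}: \boldsymbol{y}^T\boldsymbol{J}\le J_{\mathrm{ave}}\}$. The expected payoff is $Z(\boldsymbol{x},\boldsymbol{y})=\boldsymbol{x}^TZ\boldsymbol{y}$. An empty sum is $0$. A Nash equilibrium (for average power $J_{\mathrm{ave}}$) is a pair $(\boldsymbol{x}^*,\boldsymbol{y}^* )\in\mathbf{X}\times\mathbf{Y}_{\mathrm{LE}|J_{\mathrm{ave}}}$ such that $Z(\boldsymbol{x},\boldsymbol{y}^* )\le Z(\boldsymbol{x}^*,\boldsymbol{y}^* )\le Z(\boldsymbol{x}^*,\boldsymbol{y})$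 for all $\boldsymbol{x}\in\mathbf{X}$ and $\boldsymbol{y}\in\mathbf{Y}_{\mathrm{LE}|J_{\mathrm{ave}}}$; $\boldsymbol{x}^*,\boldsymbol{y}^*$ are then called optimal mixed strategies and $Z(\boldsymbol{x}^*,\boldsymbol{y}^* )$ the game value. *)

(* Defs.v *)
From mathcomp Require Export all_boot all_order all_algebra.
Export Order.TTheory GRing.Theory Num.Theory.

Set Implicit Arguments.
Unset Strict Implicit.
Unset Printing Implicit Defensive.

Local Open Scope ring_scope.

(* R is an arbitrary realFieldType, so the real numbers are an instance.
   The data J_0, ..., J_N and Z_0, ..., Z_N are given as functions on nat; only
   their values at indices <= N are used. *)

Definition power_vec (R : realFieldType) (N : nat) (J : nat -> R) :
    'cV[R]_N.+1 :=
  \col_(i < N.+1) J i.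

Definition payoff_mx (R : realFieldType) (N : nat) (Z : nat -> R) :
    'M[R]_N.+1 :=
  \matrix_(i < N.+1, j < N.+1) (if (j <= i)%N then Z i else 0).

Definition mixed (R : realFieldType) (N : nat) (x : 'cV[R]_N.+1) : Prop :=
  (forall i, 0 <= x i 0) /\ \sum_i x i 0 = 1.

(* Mixed strategies of average power at most Jave, for 0 <= Jave <= J_N; the
   range of Jave is not part of the definition. *)
Definition mixed_le (R : realFieldType) (N : nat) (J : nat -> R) (Jave : R)
    (y : 'cV[R]_N.+1) : Prop :=
  mixed y /\ (y^T *m power_vec N J) 0 0 <= Jave.

Definition payoff (R : realFieldType) (N : nat) (Z : nat -> R)
    (x y : 'cV[R]_N.+1) : R :=
  (x^T *m payoff_mx N Z *m y) 0 0.

Definition nash_equilibrium (R : realFieldType) (N : nat) (J Z : nat -> R)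
    (Jave : R) (x y : 'cV[R]_N.+1) : Prop :=
  [/\ mixed x,
      mixed_le J Jave y,
      forall x', mixed x' -> payoff Z x' y <= payoff Z x y
    & forall y', mixed_le J Jave y' -> payoff Z x y <= payoff Z x y'].

Definition Jave_thr (R : realFieldType) (J Z : nat -> R) (m : nat) : R :=
  Z m * \sum_(1 <= j < m.+1) ((Z j)^-1 - (Z j.-1)^-1) * J j.

Definition x_opt (R : realFieldType) (N : nat) (J Z : nat -> R) (m : nat) :
    'cV[R]_N.+1 :=
  \col_(i < N.+1)
    (if (i <= m)%N
     then Z m / (J m.+1 - Jave_thr J Z m) * (J i.+1 - J i) * (Z i)^-1
     else 0).

Definition y_opt (R : realFieldType) (N : nat) (Z : nat -> R) (m : nat) :
    'cV[R]_N.+1 :=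
  \col_(j < N.+1)
    (if j == 0%N :> nat then Z m * (Z 0%N)^-1
     else if (j <= m)%N then Z m * ((Z j)^-1 - (Z j.-1)^-1)
     else 0).

(* Main.v *)
(** Against [x_opt], column [j] yields at least
    [c * (J m.+1 - J j)] with [c = Z m / (J m.+1 - Jave)], by telescoping; since
    this bound is affine in [J j], any [y] of average power at most [Jave]
    concedes at least [c * (J m.+1 - Jave) = Z m].  Against [y_opt], the partial
    sums telescope to [Z m / Z i], so that row [i] yields [Z m] for [i <= m] and
    [Z i <= Z m] for [i > m].  The two guarantees meet at [Z m], which is
    therefore the payoff of every equilibrium. *)
Require Import Defs.
From mathcomp Require Import all_boot all_order all_algebra.
From mathcomp Require Import ring.

Set Implicit Arguments.
Unset Strict Implicit.
Unset Printing Implicit Defensive.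

Local Open Scope ring_scope.

Lemma le_of_lt_succ (R : realFieldType) (f : nat -> R) (n i j : nat) :
  (forall k, (k < n)%N -> f k < f k.+1) ->
  (i <= j <= n)%N -> f i <= f j.
Proof.
move=> f_incr; elim: j => [|j IHj] /andP[le_ij le_jn].
  by move: le_ij; rewrite leqn0 => /eqP->.
move: le_ij; rewrite leq_eqVlt => /predU1P[->//|lt_ij].
by rewrite (le_trans (IHj _) (ltW (f_incr _ le_jn)))// -ltnS lt_ij ltnW.
Qed.

(** Row form, suited to a fixed [y] and arbitrary [x]: row [i] depends on [y] only through a partial
    sum. *)
Lemma payoffE_rows (R : realFieldType) (N : nat) (Z : nat -> R)
    (x y : 'cV[R]_N.+1) :
  payoff Z x y = \sum_i x i 0 * (Z i * \sum_(j < N.+1 | (j <= i)%N) y j 0).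
Proof.
rewrite /payoff -mulmxA mxE; apply: eq_bigr => i _; rewrite !mxE; congr (_ * _).
rewrite mulr_sumr [RHS]big_mkcond; apply: eq_bigr => j _; rewrite mxE.
by case: ifP; rewrite ?mul0r.
Qed.

Lemma payoffE_columns (R : realFieldType) (N : nat) (Z : nat -> R)
    (x y : 'cV[R]_N.+1) :
  payoff Z x y = \sum_j y j 0 * \sum_(i < N.+1 | (j <= i)%N) x i 0 * Z i.
Proof.
rewrite /payoff mxE; apply: eq_bigr => j _; rewrite mulrC; congr (_ * _).
rewrite mxE [RHS]big_mkcond; apply: eq_bigr => i _; rewrite !mxE.
by case: ifP; rewrite ?mulr0.
Qed.

Lemma powerE (R : realFieldType) (N : nat) (J : nat -> R) (y : 'cV[R]_N.+1) :
  (y^T *m power_vec N J) 0 0 = \sum_j y j 0 * J j.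
Proof. by rewrite mxE; apply: eq_bigr => j _; rewrite !mxE. Qed.

Lemma mixed_avg_le (R : realFieldType) (N : nat) (x : 'cV[R]_N.+1)
    (f : 'I_N.+1 -> R) (c : R) :
  mixed x -> (forall i, f i <= c) -> \sum_i x i 0 * f i <= c.
Proof.
move=> [x_ge0 x_sum1] le_fc; rewrite -[leRHS]mul1r -x_sum1 mulr_suml.
by apply: ler_sum => i _; rewrite ler_wpM2l.
Qed.

Lemma sum_ord_supp_le (R : realFieldType) (N m : nat) (f : nat -> R) :
  (m <= N)%N ->
  \sum_(i < N.+1) (if (i <= m)%N then f i else 0) = \sum_(i < m.+1) f i.
Proof. by move=> le_mN; rewrite -big_mkcond [RHS](big_ord_widen N.+1). Qed.

Section Threshold.

Variables (R : realFieldType) (N : nat) (J Z : nat -> R) (m : nat).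
Hypothesis J0 : J 0%N = 0.
Hypothesis J_incr : forall i, (i < N)%N -> J i < J i.+1.
Hypothesis Z_decr : forall i, (i < N)%N -> Z i.+1 < Z i.
Hypothesis Z_pos : 0 < Z N.
Hypothesis m_lt : (m < N)%N.

Let Jave := Jave_thr J Z m.

Lemma Z_antitone (i j : nat) : (i <= j <= N)%N -> Z j <= Z i.
Proof.
move=> leijN; rewrite -lerN2.
by apply: (@le_of_lt_succ R (fun k => - Z k) N) => // k /Z_decr; rewrite ltrN2.
Qed.

Lemma Z_gt0 (i : nat) : (i <= N)%N -> 0 < Z i.
Proof. by move=> le_iN; rewrite (lt_le_trans Z_pos)// Z_antitone ?le_iN/=. Qed.

Lemma J_ge0 (i : nat) : (i <= N)%N -> 0 <= J i.
Proof. by move=> le_iN; rewrite -J0 (le_of_lt_succ J_incr). Qed.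

Lemma invZ_le (j : nat) : (0 < j <= N)%N -> (Z j.-1)^-1 <= (Z j)^-1.
Proof.
case: j => [//|j] /= lt_jN.
by rewrite lef_pV2 ?posrE ?Z_gt0 ?(ltnW lt_jN)// ltW ?Z_decr.
Qed.

Lemma Jave_ge0 : 0 <= Jave.
Proof.
have Zm_gt0 := Z_gt0 (ltnW m_lt).
rewrite mulr_ge0 ?(ltW Zm_gt0)// big_nat sumr_ge0// => j; rewrite ltnS => /andP[j_gt0 le_jm].
have le_jN := leq_trans le_jm (ltnW m_lt).
by rewrite mulr_ge0 ?J_ge0// subr_ge0 invZ_le ?j_gt0.
Qed.

(** Abel summation moves the differences from [Z^-1] to [J]. The resulting sum has positive terms,
    and it is the one that normalises [x_opt]. *)
Lemma J_succ_sub_Jave :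
  J m.+1 - Jave = Z m * \sum_(i < m.+1) (J i.+1 - J i) * (Z i)^-1.
Proof.
(* The boundary term is at [J n.+1], not [J n], because the sum on the right includes [i = n]; the
   lower boundary term vanishes by [J 0 = 0]. *)
have abel n : \sum_(1 <= j < n.+1) ((Z j)^-1 - (Z j.-1)^-1) * J j
    = (Z n)^-1 * J n.+1 - \sum_(i < n.+1) (J i.+1 - J i) * (Z i)^-1.
  elim: n => [|n IHn]; first by rewrite big_geq// big_ord1 J0; ring.
  by rewrite big_nat_recr// IHn [in RHS]big_ord_recr/=; ring.
rewrite /Jave /Jave_thr abel mulrBr mulrA divff ?mul1r; first by ring.
by rewrite gt_eqF ?Z_gt0// ltnW.
Qed.

Lemma Jave_lt : Jave < J m.+1.
Proof.
rewrite -subr_gt0 J_succ_sub_Jave mulr_gt0 ?Z_gt0 ?(ltnW m_lt)//.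
have pos i : (i <= m)%N -> 0 < (J i.+1 - J i) * (Z i)^-1.
  move=> le_im; have lt_iN := leq_ltn_trans le_im m_lt.
  by rewrite mulr_gt0 ?subr_gt0 ?J_incr ?invr_gt0 ?Z_gt0// ltnW.
(* The last term alone gives strictness. *)
rewrite big_ord_recr/= ltr_wpDl ?pos// sumr_ge0// => i _.
by rewrite ltW ?pos// ltnW.
Qed.

Let c := Z m / (J m.+1 - Jave).

Lemma slope_gt0 : 0 < c.
Proof. by rewrite divr_gt0 ?Z_gt0 ?subr_gt0 ?Jave_lt// ltnW. Qed.

Lemma x_opt_mixed : mixed (x_opt N J Z m).
Proof.
split=> [i|].
  rewrite mxE; case: ifP => // le_im.
  have lt_iN := leq_ltn_trans le_im m_lt.
  rewrite -mulrA mulr_ge0 ?(ltW slope_gt0)// mulr_ge0 ?subr_ge0 ?ltW ?J_incr//.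
  by rewrite invr_gt0 Z_gt0 1?ltnW.
under eq_bigr do rewrite mxE.
rewrite (sum_ord_supp_le (fun i => c * (J i.+1 - J i) * (Z i)^-1)) ?(ltnW m_lt)//.
under eq_bigr do rewrite -mulrA.
rewrite -mulr_sumr mulrAC -J_succ_sub_Jave divff//.
by rewrite gt_eqF// subr_gt0 Jave_lt.
Qed.

Lemma x_opt_column_ge (j : 'I_N.+1) :
  c * (J m.+1 - J j) <= \sum_(i < N.+1 | (j <= i)%N) x_opt N J Z m i 0 * Z i.
Proof.
have -> : \sum_(i < N.+1 | (j <= i)%N) x_opt N J Z m i 0 * Z i
    = \sum_(j <= i < m.+1) c * (J i.+1 - J i).
  rewrite (big_nat_widen _ _ N.+1) ?ltnS ?(ltnW m_lt)//= big_geq_mkord.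
  rewrite [RHS]big_mkcondl; apply: eq_bigr => i _; rewrite mxE ltnS.
  case: ifP; rewrite ?mul0r// => _.
  by rewrite mulfVK// gt_eqF ?Z_gt0// -ltnS.
rewrite -mulr_sumr (ler_pM2l slope_gt0).
(* Up to [j = m.+1] the bound is an equality; beyond, the sum is empty and [J m.+1 - J j] is
   nonpositive. *)
case: (leqP j m.+1) => [le_jm|lt_mj]; first by rewrite telescope_sumr.
rewrite big_geq ?(ltnW lt_mj)// subr_le0 (le_of_lt_succ J_incr)//.
by rewrite (ltnW lt_mj) -ltnS ltn_ord.
Qed.

Lemma x_opt_guarantee (y : 'cV[R]_N.+1) :
  mixed_le J Jave y -> Z m <= payoff Z (x_opt N J Z m) y.
Proof.
move=> [[y_ge0 y_sum1]]; rewrite powerE payoffE_columns => le_pow.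
apply: (@le_trans _ _ (\sum_j y j 0 * (c * (J m.+1 - J j)))); last first.
  by apply: ler_sum => j _; rewrite ler_wpM2l// x_opt_column_ge.
have -> : \sum_j y j 0 * (c * (J m.+1 - J j))
    = c * (J m.+1 - \sum_j y j 0 * J j).
  (* The constant [J m.+1] is averaged against [y], which has total mass 1. *)
  rewrite -[X in c * (X - _)]mul1r -y_sum1 mulr_suml -sumrB mulr_sumr.
  by apply: eq_bigr => j _; ring.
have <- : c * (J m.+1 - Jave) = Z m.
  by rewrite mulfVK// gt_eqF// subr_gt0 Jave_lt.
by rewrite (ler_pM2l slope_gt0) lerD2l lerN2.
Qed.

(** The weights vanish beyond [m], so the telescoping sum freezes at index [m]; hence the [minn]. *)
Lemma y_opt_partial_sum (i : nat) : (i <= N)%N ->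
  \sum_(j < N.+1 | (j <= i)%N) y_opt N Z m j 0 = Z m / Z (minn i m).
Proof.
under eq_bigr do rewrite mxE.
move=> le_iN; set f := fun j : nat => if j == 0%N then Z m * (Z 0%N)^-1
  else if (j <= m)%N then Z m * ((Z j)^-1 - (Z j.-1)^-1) else 0.
rewrite -[LHS](@big_ord_widen _ _ _ i.+1 N.+1 f)// {le_iN}.
elim: i => [|i IHi]; first by rewrite big_ord1 min0n.
rewrite big_ord_recr/= IHi /f/=; case: (leqP i.+1 m) => [lt_im|le_mi].
  by rewrite (minn_idPl (ltnW lt_im)); ring.
by rewrite addr0 (@minn_idPr i m le_mi).
Qed.

(** The weights are nonnegative because [Z^-1] increases, and [Jave] is exactly the average power of
    [y_opt]. *)
Lemma y_opt_mixed_le : mixed_le J Jave (y_opt N Z m).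
Proof.
have Zm_gt0 : 0 < Z m by rewrite Z_gt0// ltnW.
split; first split=> [j|].
- rewrite mxE; case: eqP => [_|/eqP j_neq0].
    by rewrite mulr_ge0 ?invr_ge0 ?(ltW Zm_gt0) ?(ltW (Z_gt0 _)).
  case: ifP => // le_jm; rewrite mulr_ge0 ?(ltW Zm_gt0)// subr_ge0 invZ_le//.
  by rewrite lt0n j_neq0 -ltnS ltn_ord.
(* The total mass is the partial sum at [i = N], namely [Z m / Z m]. *)
- have := y_opt_partial_sum (leqnn N).
  rewrite (minn_idPr (ltnW m_lt)) divff ?gt_eqF// => <-.
  by apply: eq_bigl => j; rewrite -ltnS ltn_ord.
rewrite powerE /Jave /Jave_thr.
set g := fun j : nat => Z m * (((Z j)^-1 - (Z j.-1)^-1) * J j).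
have -> : \sum_j y_opt N Z m j 0 * J j
    = \sum_(j < N.+1) (if (j <= m)%N then g j else 0).
  apply: eq_bigr => j _; rewrite mxE /g.
  (* The special weight at index 0 does not matter here: [J 0 = 0] cancels it. *)
  case: eqP => [->|_]; first by rewrite J0 !mulr0.
  by case: ifP; rewrite ?mul0r ?mulrA.
rewrite (sum_ord_supp_le g (ltnW m_lt)) -(big_mkord xpredT g) big_ltn//.
by rewrite {1}/g J0 !mulr0 add0r mulr_sumr.
Qed.

Lemma y_opt_guarantee (x : 'cV[R]_N.+1) :
  mixed x -> payoff Z x (y_opt N Z m) <= Z m.
Proof.
move=> x_mixed; rewrite payoffE_rows; apply: mixed_avg_le => // i.
have le_iN : (i <= N)%N by rewrite -ltnS.
rewrite y_opt_partial_sum//; case: (leqP i m) => [le_im|lt_mi].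
  by rewrite mulrC mulfVK// gt_eqF ?Z_gt0.
rewrite divff ?mulr1 ?Z_antitone ?(ltnW lt_mi)//.
by rewrite gt_eqF ?Z_gt0// ltnW.
Qed.

Lemma nash_value (x y : 'cV[R]_N.+1) :
  nash_equilibrium J Z Jave x y -> payoff Z x y = Z m.
Proof.
move=> [x_mixed y_mixed best_x best_y]; apply: le_anti; apply/andP; split.
  (* The jammer deviates to [y_opt] for the upper bound; then the transmitter deviates to [x_opt]
     for the lower one. *)
  exact: le_trans (best_y _ y_opt_mixed_le) (y_opt_guarantee x_mixed).
exact: le_trans (x_opt_guarantee y_mixed) (best_x _ x_opt_mixed).
Qed.

(** Each deviation is compared through [Z m]: one guarantee bounds the deviating payoff, the other
    the payoff of the pair itself. *)
Lemma nash_opt : nash_equilibrium J Z Jave (x_opt N J Z m) (y_opt N Z m).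
Proof.
split; [exact: x_opt_mixed|exact: y_opt_mixed_le| |].
- move=> x /y_opt_guarantee/le_trans; apply.
  exact: x_opt_guarantee y_opt_mixed_le.
- move=> y /x_opt_guarantee; apply: le_trans.
  exact: y_opt_guarantee x_opt_mixed.
Qed.

End Threshold.

Theorem theorem2 (R : realFieldType) (N : nat) (J Z : nat -> R) (m : nat)
    (N_ge1 : (1 <= N)%N)
    (J0 : J 0%N = 0)
    (J_incr : forall i, (i < N)%N -> J i < J i.+1)
    (Z_decr : forall i, (i < N)%N -> Z i.+1 < Z i)
    (Z_pos : 0 < Z N)
    (m_lt : (m < N)%N) :
  [/\ 0 <= Jave_thr J Z m <= J N,
      nash_equilibrium J Z (Jave_thr J Z m) (x_opt N J Z m) (y_opt N Z m)
    & forall x y : 'cV[R]_N.+1,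
        nash_equilibrium J Z (Jave_thr J Z m) x y -> payoff Z x y = Z m].
Proof.
split.
(* The upper bound passes through [J m.+1], which is at most [J N] since [m < N]. *)
- rewrite (@Jave_ge0 R N)//= (le_trans (ltW (Jave_lt J0 J_incr Z_decr Z_pos m_lt)))//.
  by rewrite (le_of_lt_succ J_incr) ?m_lt/=.
- exact: nash_opt.
- exact: nash_value.
Qed.
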